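(* The two-center problem in the plane, with Hamiltonian $$H=\frac{|p|^2}{2}-\frac{m_1}{|q-1|}-\frac{m_2}{|q+1|},\qquad q\in\mathbb{C}\setminus\{-1,1\},\ p\in\mathbb{C},$$ where the mass factors $m_1,m_2\in\mathbb{R}$ can take both signs, admits any combination of confocal ellipses and confocal hyperbolae as an integrable reflection wall.
   Context: Confocal ellipses and hyperbolae are those having the two centers $-1,1\in\mathbb{C}$ as foci. A combination of curves means that the reflection wall is a union of such curves. A wall $\mathcal{B}$ is an integrable reflection wall for the system if the mechanical billiard, in which the particle moves according to $H$ and is reflected elastically at $\mathcal{B}$ (tangential component of the momentum kept, normal component reversed), possesses on each energy hypersurface of $H$ an additional non-trivial first integral, independent of $H$, preserved by the motion and by the reflections at all curves of $\mathcal{B}$. It is not required that the billiard mapping be always well-defined. *)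

(* Defs.v *)
From Stdlib Require Import Reals.
From Coquelicot Require Import Coquelicot.
Open Scope R_scope.

(** * Phase space of a particle in the plane *)

(** A pair [(q, p)]. *)
Definition phase := (C * C)%type.

Inductive coordinate := Cq1 | Cq2 | Cp1 | Cp2.

Definition coord (k : coordinate) (z : phase) : R :=
  match k with
  | Cq1 => Re (fst z)
  | Cq2 => Im (fst z)
  | Cp1 => Re (snd z)
  | Cp2 => Im (snd z)
  end.

Definition set_coord (k : coordinate) (z : phase) (s : R) : phase :=
  match k with
  | Cq1 => ((s, Im (fst z)), snd z)
  | Cq2 => ((Re (fst z), s), snd z)
  | Cp1 => (fst z, (s, Im (snd z)))
  | Cp2 => (fst z, (Re (snd z), s))
  end.

Definition partial (k : coordinate) (F : phase -> R) (z : phase) : R :=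
  Derive (fun s => F (set_coord k z s)) (coord k z).

Definition ex_partial (k : coordinate) (F : phase -> R) (z : phase) : Prop :=
  ex_derive (fun s => F (set_coord k z s)) (coord k z).

(** In what follows [Q] is the configuration space, an open subset of the
    plane; the phase space is [Q x C]. *)

Fixpoint class_C (n : nat) (Q : C -> Prop) (F : phase -> R) : Prop :=
  (forall z, Q (fst z) -> continuous F z) /\
  match n with
  | O => True
  | S m => forall k,
      (forall z, Q (fst z) -> ex_partial k F z) /\ class_C m Q (partial k F)
  end.

Definition smooth (Q : C -> Prop) (F : phase -> R) : Prop :=
  forall n, class_C n Q F.

(** * Hamiltonian motion *)

(** Hamilton's equations on the time interval [(a, b)]; the solution stays in
    the phase space, so it has no collision with a center. *)
Definition motion (Q : C -> Prop) (H : phase -> R) (a b : R) (z : R -> phase)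
  : Prop :=
  forall t, a < t < b ->
    Q (fst (z t)) /\
    is_derive (fun s => coord Cq1 (z s)) t (partial Cp1 H (z t)) /\
    is_derive (fun s => coord Cq2 (z s)) t (partial Cp2 H (z t)) /\
    is_derive (fun s => coord Cp1 (z s)) t (- partial Cq1 H (z t)) /\
    is_derive (fun s => coord Cp2 (z s)) t (- partial Cq2 H (z t)).

Definition on_energy_level (Q : C -> Prop) (H : phase -> R) (e : R) (z : phase)
  : Prop :=
  Q (fst z) /\ H z = e.

(** The points of the level at which it is a hypersurface: [dH <> 0]. *)
Definition on_energy_hypersurface (Q : C -> Prop) (H : phase -> R) (e : R)
  (z : phase) : Prop :=
  on_energy_level Q H e z /\ exists k, partial k H z <> 0.

Definition independent_at (H F : phase -> R) (z : phase) : Prop :=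
  forall a b : R,
    (forall k, a * partial k H z + b * partial k F z = 0) -> a = 0 /\ b = 0.

(** * Elastic reflection *)

Definition dot (u v : C) : R := Re u * Re v + Im u * Im v.

Definition tangent_to (G : C -> Prop) (q v : C) : Prop :=
  exists g : R -> C,
    g 0 = q /\
    locally 0 (fun s => G (g s)) /\
    is_derive (fun s => Re (g s)) 0 (Re v) /\
    is_derive (fun s => Im (g s)) 0 (Im v).

(** [p'] is the momentum after an elastic reflection of [p] at [q] on [G];
    [Ci * v] is normal to [G]. *)
Definition elastic_reflection (G : C -> Prop) (q p p' : C) : Prop :=
  exists v : C,
    v <> RtoC 0 /\ tangent_to G q v /\
    dot p' v = dot p v /\
    dot p' (Ci * v)%C = - dot p (Ci * v)%C.

(** * Integrable reflection walls *)

(** A wall is given by the family [W] of the curves of which it is the union: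
    at a common point of two of them a reflection at either is possible.

    Independence on a dense subset of the energy hypersurface implies that [F]
    is not constant on any nonempty open subset of it. Only at [dH <> 0] can
    independence be asked for (for the free particle, [dH] vanishes on the whole
    level of energy [0]); invariance is asked for on the whole level. *)
Definition first_integral_of_billiard (Q : C -> Prop) (H : phase -> R)
  (W : (C -> Prop) -> Prop) (e : R) (F : phase -> R) : Prop :=
  smooth Q F /\
  (forall z, on_energy_hypersurface Q H e z ->
     forall N : phase -> Prop, locally z N ->
     exists z', N z' /\ on_energy_hypersurface Q H e z' /\
                independent_at H F z') /\
  (forall a b (z : R -> phase), motion Q H a b z ->
     (forall t, a < t < b -> on_energy_level Q H e (z t)) ->
     forall s t, a < s < b -> a < t < b -> F (z s) = F (z t)) /\
  (forall G, W G -> forall q p p' : C,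
     G q -> on_energy_level Q H e (q, p) ->
     elastic_reflection G q p p' -> F (q, p') = F (q, p)).

(** The first integral may depend on the energy. *)
Definition integrable_reflection_wall (Q : C -> Prop) (H : phase -> R)
  (W : (C -> Prop) -> Prop) : Prop :=
  forall e : R, exists F : phase -> R, first_integral_of_billiard Q H W e F.

(** * Conics with given foci *)

Definition ellipse_with_foci (f1 f2 : C) (G : C -> Prop) : Prop :=
  exists a : R, Cmod (f1 - f2) < 2 * a /\
    forall q : C, G q <-> Cmod (q - f1) + Cmod (q - f2) = 2 * a.

(** Both branches. *)
Definition hyperbola_with_foci (f1 f2 : C) (G : C -> Prop) : Prop :=
  exists a : R, 0 < 2 * a < Cmod (f1 - f2) /\
    forall q : C, G q <-> Rabs (Cmod (q - f1) - Cmod (q - f2)) = 2 * a.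

Definition confocal_ellipse : (C -> Prop) -> Prop :=
  ellipse_with_foci (RtoC (-1)) (RtoC 1).

Definition confocal_hyperbola : (C -> Prop) -> Prop :=
  hyperbola_with_foci (RtoC (-1)) (RtoC 1).

(** * The two-center problem *)

Definition off_centers (q : C) : Prop := q <> RtoC (-1) /\ q <> RtoC 1.

Definition two_center_H (m1 m2 : R) (z : phase) : R :=
  let (q, p) := z in
  Cmod p ^ 2 / 2 - m1 / Cmod (q - RtoC 1) - m2 / Cmod (q + RtoC 1).

(* Main.v *)
(** A first integral is the Erikson-Hill function
    [L1 * L2 - 2 m1 (x - 1) / r1 + 2 m2 (x + 1) / r2], where [L1], [L2] are the
    angular momenta about the centers [1], [-1] and [r1], [r2] the distances to
    them. Only the product [L1 * L2] depends on the momentum. At a point of a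
    confocal conic it is a quadratic form in the momentum which, by the optical
    property (the focal lines are exchanged by the reflection), is diagonal in
    the basis of the tangent and the normal, hence invariant under reflection.

    For fixed position, rotating a nonzero momentum keeps the energy, and the
    differentials are dependent only if the momentum is tangent or normal to the
    conics through the point, so rotating slightly gives independence. If the
    momentum is zero and [dH <> 0], one first moves the position slightly so as
    to decrease the potential, and restores the energy by a small momentum. *)

Require Import Defs.
From Stdlib Require Import Reals Lra Classical.
From Coquelicot Require Import Coquelicot.
Open Scope R_scope.

(** * Distances to points of the real axis and to the centers *)

Lemma Cmod_sub_real (q : C) (c : R) :
  Cmod (q - RtoC c) = sqrt ((Re q - c) ^ 2 + Im q ^ 2).
Proof.
  unfold Cmod, Re, Im. cbn. f_equal. ring.
Qed.

Lemma Cmod_sub_real_sqr (q : C) (c : R) :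
  Cmod (q - RtoC c) ^ 2 = (Re q - c) ^ 2 + Im q ^ 2.
Proof.
  rewrite Cmod_sub_real. apply pow2_sqrt, Rplus_le_le_0_compat; apply pow2_ge_0.
Qed.

Lemma is_derive_eq_value (f : R -> R) (t l l' : R) :
  is_derive f t l -> l = l' -> is_derive f t l'.
Proof.
  intros h <-. exact h.
Qed.

Lemma is_derive_sqrt_sum_sqr (x y : R -> R) (t dx dy : R) :
  is_derive x t dx -> is_derive y t dy -> 0 < x t ^ 2 + y t ^ 2 ->
  is_derive (fun s => sqrt (x s ^ 2 + y s ^ 2)) t
    ((x t * dx + y t * dy) / sqrt (x t ^ 2 + y t ^ 2)).
Proof.
  intros hx hy hpos. pose proof (sqrt_lt_R0 _ hpos) as hs. auto_derive.
  - repeat split; trivial; eexists; eassumption.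
  - pose proof (is_derive_unique _ _ _ hx) as ex.
    pose proof (is_derive_unique _ _ _ hy) as ey.
    change (Derive (fun s => x s) t = dx) in ex.
    change (Derive (fun s => y s) t = dy) in ey.
    rewrite ex, ey. cbn in *. field. lra.
Qed.

Lemma is_derive_Cmod_sub_real (g : R -> C) (c t d1 d2 : R) :
  is_derive (fun s => Re (g s)) t d1 ->
  is_derive (fun s => Im (g s)) t d2 ->
  0 < Cmod (g t - RtoC c) ->
  is_derive (fun s => Cmod (g s - RtoC c)) t
    (((Re (g t) - c) * d1 + Im (g t) * d2) / Cmod (g t - RtoC c)).
Proof.
  intros h1 h2 hpos.
  apply (is_derive_ext (fun s => sqrt ((Re (g s) - c) ^ 2 + Im (g s) ^ 2))).
  { intros s. symmetry. apply Cmod_sub_real. }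
  assert (hpos2 : 0 < (Re (g t) - c) ^ 2 + Im (g t) ^ 2).
  { rewrite <- Cmod_sub_real_sqr. apply pow_lt, hpos. }
  rewrite Cmod_sub_real.
  apply (is_derive_sqrt_sum_sqr (fun s => Re (g s) - c)); trivial.
  eapply is_derive_eq_value;
    [apply (is_derive_minus _ (fun _ => c) _ _ _ h1 (is_derive_const c t))|].
  cbn. ring.
Qed.

(** [m1] sits at [center true] and [m2] at [center false]. *)
Definition center (b : bool) : R := if b then 1 else -1.

Lemma off_centers_iff (q : C) :
  off_centers q <-> forall b, 0 < Cmod (q - RtoC (center b)).
Proof.
  assert (hsub : forall c, q <> RtoC c <-> 0 < Cmod (q - RtoC c)).
  { intros c. split.
    - intros hne. apply Cmod_gt_0. intros h0. apply hne.
      replace q with ((q - RtoC c) + RtoC c)%C by ring. rewrite h0. ring.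
    - intros hpos ->. replace (RtoC c - RtoC c)%C with (RtoC 0) in hpos by ring.
      rewrite Cmod_0 in hpos. lra. }
  unfold off_centers. rewrite !hsub. split.
  - intros [h1 h2] [|]; assumption.
  - intros h. split; [exact (h false) | exact (h true)].
Qed.

(** * Continuity on phase space *)

Lemma continuous_coord (k : coordinate) (z : phase) : continuous (coord k) z.
Proof.
  destruct z as [[x y] [u v]].
  destruct k.
  - apply (continuous_comp fst fst); apply continuous_fst.
  - apply (continuous_comp fst snd); [apply continuous_fst | apply continuous_snd].
  - apply (continuous_comp snd fst); [apply continuous_snd | apply continuous_fst].
  - apply (continuous_comp snd snd); apply continuous_snd.
Qed.

Lemma continuous_dist_center (b : bool) (z : phase) :
  continuous (fun w : phase => Cmod (fst w - RtoC (center b))) z.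
Proof.
  apply (continuous_ext
    (fun w : phase => sqrt ((coord Cq1 w - center b) * (coord Cq1 w - center b)
                            + coord Cq2 w * coord Cq2 w))).
  { intros w. rewrite Cmod_sub_real. cbn. f_equal. ring. }
  apply (continuous_comp _ sqrt); [| apply continuous_sqrt].
  assert (h1 : continuous (fun w : phase => coord Cq1 w - center b) z).
  { apply (continuous_minus (coord Cq1) (fun _ => center b));
      [apply continuous_coord | apply continuous_const]. }
  apply (continuous_plus
    (fun w : phase => (coord Cq1 w - center b) * (coord Cq1 w - center b))
    (fun w : phase => coord Cq2 w * coord Cq2 w)).
  - exact (continuous_mult _ _ _ h1 h1).
  - apply (continuous_mult (coord Cq2) (coord Cq2)); apply continuous_coord.
Qed.

Lemma locally_positive {T : UniformSpace} (f : T -> R) (x : T) :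
  continuous f x -> 0 < f x -> locally x (fun y => 0 < f y).
Proof.
  intros hf hpos. apply hf. apply (open_gt 0 (f x) hpos).
Qed.

Lemma locally_off_centers (z : phase) :
  off_centers (fst z) -> locally z (fun w : phase => off_centers (fst w)).
Proof.
  intros hz. rewrite off_centers_iff in hz.
  generalize (filter_and _ _
    (locally_positive _ z (continuous_dist_center true z) (hz true))
    (locally_positive _ z (continuous_dist_center false z) (hz false))).
  apply filter_imp. intros w [h1 h2]. apply off_centers_iff. intros [|]; assumption.
Qed.

Lemma is_derive_set_coord (k j : coordinate) (z : phase) (s : R) :
  is_derive (fun s => coord j (set_coord k z s)) s
    (match k, j with
     | Cq1, Cq1 | Cq2, Cq2 | Cp1, Cp1 | Cp2, Cp2 => 1
     | _, _ => 0
     end).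
Proof.
  destruct k, j; cbn; auto_derive; trivial.
Qed.

Lemma set_coord_id (k : coordinate) (z : phase) : set_coord k z (coord k z) = z.
Proof.
  destruct z as [[x y] [u v]]; destruct k; reflexivity.
Qed.

Lemma continuous_set_coord (k : coordinate) (z : phase) (s : R) :
  continuous (set_coord k z) s.
Proof.
  destruct z as [[x y] [u v]]. intros P [eps hP]. exists eps. intros t ht.
  apply hP. destruct k; repeat split; try apply ball_center; exact ht.
Qed.

Lemma locally_set_coord (k : coordinate) (z : phase) (P : phase -> Prop) :
  locally z P -> locally (coord k z) (fun s => P (set_coord k z s)).
Proof.
  intros hP. apply (continuous_set_coord k z (coord k z)).
  rewrite set_coord_id. exact hP.
Qed.

(** * Symbolic differentiation and smoothness *)

(** A class of functions closed under the partial derivatives and containing the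
    Hamiltonian and the first integral, differentiated symbolically. *)
Inductive expr :=
  | Const (c : R)
  | Var (k : coordinate)
  | InvDist (b : bool)
  | Add (E1 E2 : expr)
  | Mul (E1 E2 : expr).

Fixpoint eval (E : expr) (z : phase) : R :=
  match E with
  | Const c => c
  | Var k => coord k z
  | InvDist b => / Cmod (fst z - RtoC (center b))
  | Add E1 E2 => eval E1 z + eval E2 z
  | Mul E1 E2 => eval E1 z * eval E2 z
  end.

(** The gradient of [1 / r] is [- (q - c) / r ^ 3], so polynomials in the coordinates and the two
    inverse distances suffice for derivatives of every order. *)
Fixpoint diff (k : coordinate) (E : expr) : expr :=
  match E with
  | Const _ => Const 0
  | Var j =>
      Const (match k, j with
             | Cq1, Cq1 | Cq2, Cq2 | Cp1, Cp1 | Cp2, Cp2 => 1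
             | _, _ => 0
             end)
  | InvDist b =>
      let cube := Mul (InvDist b) (Mul (InvDist b) (InvDist b)) in
      match k with
      | Cq1 => Mul (Add (Const (center b)) (Mul (Const (-1)) (Var Cq1))) cube
      | Cq2 => Mul (Mul (Const (-1)) (Var Cq2)) cube
      | _ => Const 0
      end
  | Add E1 E2 => Add (diff k E1) (diff k E2)
  | Mul E1 E2 => Add (Mul (diff k E1) E2) (Mul E1 (diff k E2))
  end.

(** The chain rule along an arbitrary curve serves twice: on coordinate lines it yields the partial
    derivatives, on solutions of Hamilton's equations the conservation law. *)
Lemma is_derive_eval (E : expr) (z : R -> phase) (t : R) (d : coordinate -> R) :
  off_centers (fst (z t)) ->
  (forall k, is_derive (fun s => coord k (z s)) t (d k)) ->
  is_derive (fun s => eval E (z s)) t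
    (eval (diff Cq1 E) (z t) * d Cq1 + eval (diff Cq2 E) (z t) * d Cq2
     + eval (diff Cp1 E) (z t) * d Cp1 + eval (diff Cp2 E) (z t) * d Cp2).
Proof.
  intros hz hd. rewrite off_centers_iff in hz.
  induction E as [c | k | b | E1 IH1 E2 IH2 | E1 IH1 E2 IH2]; cbn [eval diff].
  - apply (is_derive_ext_loc (fun _ => c)); [apply filter_forall; reflexivity|].
    eapply is_derive_eq_value; [apply is_derive_const|]. cbn. ring.
  - eapply is_derive_eq_value; [apply hd|]. destruct k; ring.
  - specialize (hz b).
    eapply is_derive_eq_value.
    { apply is_derive_inv; [| lra].
      apply (is_derive_Cmod_sub_real (fun s => fst (z s)) _ _ _ _
               (hd Cq1) (hd Cq2) hz). }
    cbn. unfold Re, Im. field. lra.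
  - eapply is_derive_eq_value;
      [apply (is_derive_plus (fun s => eval E1 (z s)) (fun s => eval E2 (z s))
                _ _ _ IH1 IH2)|]. cbn. ring.
  - eapply is_derive_eq_value;
      [apply (is_derive_mult (fun s => eval E1 (z s)) (fun s => eval E2 (z s))
                _ _ _ IH1 IH2 Rmult_comm)|].
    cbn. ring.
Qed.

Lemma is_derive_eval_set_coord (E : expr) (k : coordinate) (z : phase) :
  off_centers (fst z) ->
  is_derive (fun s => eval E (set_coord k z s)) (coord k z) (eval (diff k E) z).
Proof.
  intros hz.
  eapply is_derive_eq_value.
  { apply (is_derive_eval E (set_coord k z) (coord k z)).
    - rewrite set_coord_id. exact hz.
    - intros j. apply is_derive_set_coord. }
  rewrite set_coord_id. destruct k; cbn; ring.
Qed.

(** A partial derivative sees [F] only near [z], and the set off the centers is open. Asking for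
    agreement only there allows iteration with [partial k F] in place of [F]. *)
Lemma partial_eval (E : expr) (F : phase -> R) (k : coordinate) (z : phase) :
  (forall w, off_centers (fst w) -> F w = eval E w) ->
  off_centers (fst z) ->
  ex_partial k F z /\ partial k F z = eval (diff k E) z.
Proof.
  intros hF hz.
  assert (h : is_derive (fun s => F (set_coord k z s)) (coord k z)
                (eval (diff k E) z)).
  { apply (is_derive_ext_loc (fun s => eval E (set_coord k z s))).
    - apply (locally_set_coord k z (fun w => eval E w = F w)).
      generalize (locally_off_centers z hz). apply filter_imp.
      intros w hw. symmetry. apply hF, hw.
    - apply is_derive_eval_set_coord, hz. }
  split; [eexists; exact h | exact (is_derive_unique _ _ _ h)].
Qed.

Lemma continuous_eval (E : expr) (z : phase) :
  off_centers (fst z) -> continuous (eval E) z.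
Proof.
  intros hz.
  induction E as [c | k | b | E1 IH1 E2 IH2 | E1 IH1 E2 IH2].
  - apply continuous_const.
  - apply continuous_coord.
  - apply (continuous_comp
      (fun w : phase => Cmod (fst w - RtoC (center b))) Rinv).
    + apply continuous_dist_center.
    + apply continuous_Rinv. rewrite off_centers_iff in hz. specialize (hz b). lra.
  - exact (continuous_plus _ _ _ IH1 IH2).
  - exact (continuous_mult _ _ _ IH1 IH2).
Qed.

Lemma smooth_eval (E : expr) : smooth off_centers (eval E).
Proof.
  intros n.
  (* Iterated partial derivatives are known to agree with expressions only off the centers, so the
     induction runs over all [F] that agree with one there. *)
  enough (h : forall F : phase -> R,
    (forall w, off_centers (fst w) -> F w = eval E w) -> class_C n off_centers F)
    by exact (h (eval E) (fun _ _ => eq_refl)).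
  revert E. induction n as [|n IH]; intros E F hF; cbn [class_C].
  all: assert (hc : forall z : phase, off_centers (fst z) -> continuous F z)
    by (intros z hz;
        apply (continuous_ext_loc F (eval E));
        [ generalize (locally_off_centers z hz); apply filter_imp;
          exact (fun w hw => eq_sym (hF w hw))
        | apply continuous_eval, hz ]).
  - split; trivial.
  - split; [exact hc|]. intros k. split.
    + intros z hz. apply (partial_eval E F k z hF hz).
    + apply (IH (diff k E)). intros w hw. apply (partial_eval E F k w hF hw).
Qed.

(** * The Erikson-Hill function and its conservation along the motion *)

Definition energy (m1 m2 : R) : expr :=
  Add (Mul (Const (/ 2))
         (Add (Mul (Var Cp1) (Var Cp1)) (Mul (Var Cp2) (Var Cp2))))
    (Add (Mul (Const (- m1)) (InvDist true)) (Mul (Const (- m2)) (InvDist false))).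

Definition shifted_abscissa (b : bool) : expr := Add (Var Cq1) (Const (- center b)).

Definition angular_momentum (b : bool) : expr :=
  Add (Mul (shifted_abscissa b) (Var Cp2))
    (Mul (Const (-1)) (Mul (Var Cq2) (Var Cp1))).

Definition erikson_hill (m1 m2 : R) : expr :=
  Add (Mul (angular_momentum true) (angular_momentum false))
    (Add (Mul (Const (-2 * m1)) (Mul (shifted_abscissa true) (InvDist true)))
       (Mul (Const (2 * m2)) (Mul (shifted_abscissa false) (InvDist false)))).

Lemma two_center_H_eval (m1 m2 : R) (z : phase) :
  two_center_H m1 m2 z = eval (energy m1 m2) z.
Proof.
  destruct z as [q [u v]].
  assert (hp : Cmod (u, v) ^ 2 = u ^ 2 + v ^ 2).
  { apply pow2_sqrt, Rplus_le_le_0_compat; apply pow2_ge_0. }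
  unfold two_center_H. rewrite hp. cbn.
  replace (q + RtoC 1)%C with (q - RtoC (-1))%C
    by (apply injective_projections; cbn; ring).
  unfold Rdiv. ring.
Qed.

Lemma partial_two_center_H (m1 m2 : R) (k : coordinate) (z : phase) :
  off_centers (fst z) ->
  partial k (two_center_H m1 m2) z = eval (diff k (energy m1 m2)) z.
Proof.
  intros hz. apply partial_eval; [| exact hz].
  intros w _. apply two_center_H_eval.
Qed.

Lemma partial_eval_self (E : expr) (k : coordinate) (z : phase) :
  off_centers (fst z) -> partial k (eval E) z = eval (diff k E) z.
Proof.
  intros hz. apply partial_eval; trivial.
Qed.

(** With the inverse distances as free variables [i1], [i2], the bracket is a polynomial, and it is
    a combination of the relations [i - r ^ 2 * i ^ 3 = 0], where [r ^ 2] is written in the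
    coordinates. *)
Lemma poisson_bracket_erikson_hill (m1 m2 : R) (z : phase) :
  off_centers (fst z) ->
  let dF k := eval (diff k (erikson_hill m1 m2)) z in
  let dH k := eval (diff k (energy m1 m2)) z in
  dF Cq1 * dH Cp1 + dF Cq2 * dH Cp2 - dF Cp1 * dH Cq1 - dF Cp2 * dH Cq2 = 0.
Proof.
  intros hz. rewrite off_centers_iff in hz.
  pose proof (hz true) as h1. pose proof (hz false) as h2.
  pose proof (Cmod_sub_real_sqr (fst z) (center true)) as e1.
  pose proof (Cmod_sub_real_sqr (fst z) (center false)) as e2.
  assert (hinv : forall r d, 0 < r -> r ^ 2 = d -> / r - d * (/ r * (/ r * / r)) = 0).
  { intros r d hr <-. field. lra. }
  apply (hinv _ _ h1) in e1. apply (hinv _ _ h2) in e2. clear h1 h2 hinv.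
  destruct z as [[x y] [u v]]. cbn in *. revert e1 e2.
  generalize (/ Cmod ((x, y) - RtoC 1)) as i1.
  generalize (/ Cmod ((x, y) - RtoC (-1))) as i2. intros i2 i1 e1 e2.
  (* The terms of the bracket linear in [i1] and [i2] are [-2 * m1 * u * i1] and [2 * m2 * u * i2],
     which fixes the coefficients. *)
  match type of e1 with ?d1 = 0 => match type of e2 with ?d2 = 0 =>
    transitivity (-2 * m1 * u * d1 + 2 * m2 * u * d2) end end.
  - field.
  - rewrite e1, e2. ring.
Qed.

Lemma eq_of_is_derive_0 (f : R -> R) (a b : R) :
  (forall t, a < t < b -> is_derive f t 0) ->
  forall s t, a < s < b -> a < t < b -> f s = f t.
Proof.
  intros hf.
  assert (hlt : forall s t, a < s < b -> a < t < b -> s < t -> f s = f t).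
  { intros s t hs ht hst.
    apply (eq_is_derive f s t); [| exact hst]. intros r hr. apply hf. lra. }
  intros s t hs ht. destruct (Rtotal_order s t) as [h | [-> | h]]; auto.
  symmetry. auto.
Qed.

Lemma erikson_hill_motion (m1 m2 a b : R) (z : R -> phase) :
  motion off_centers (two_center_H m1 m2) a b z ->
  forall s t, a < s < b -> a < t < b ->
  eval (erikson_hill m1 m2) (z s) = eval (erikson_hill m1 m2) (z t).
Proof.
  intros hz. apply eq_of_is_derive_0. intros t ht.
  destruct (hz t ht) as (hq & h1 & h2 & h3 & h4).
  rewrite partial_two_center_H in h1, h2, h3, h4 by exact hq.
  set (dH k := eval (diff k (energy m1 m2)) (z t)).
  eapply is_derive_eq_value.
  { apply (is_derive_eval (erikson_hill m1 m2) z t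
      (fun k => match k with
                | Cq1 => dH Cp1 | Cq2 => dH Cp2
                | Cp1 => - dH Cq1 | Cp2 => - dH Cq2
                end) hq).
    intros [| | |]; assumption. }
  rewrite <- (poisson_bracket_erikson_hill m1 m2 (z t) hq).
  unfold dH. ring.
Qed.

(** * Reflection at confocal conics *)

(** The optical property for a tangent [v]: [eps] is [1] for an ellipse and [-1]
    for a hyperbola, and the conclusion says that [v] and [Ci * v] are conjugate
    for the product of the two angular momenta. The hypothesis on [4] excludes the
    degenerate conics (the segment between the foci and the rays outside it). *)
Lemma focal_lines_reflected (x y v1 v2 r1 r2 eps : R) :
  eps ^ 2 = 1 -> 0 < r1 -> 0 < r2 -> 0 < v1 ^ 2 + v2 ^ 2 ->
  r1 ^ 2 = (x - 1) ^ 2 + y ^ 2 -> r2 ^ 2 = (x + 1) ^ 2 + y ^ 2 ->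
  (r1 + eps * r2) ^ 2 <> 4 ->
  ((x - 1) * v1 + y * v2) / r1 + eps * (((x + 1) * v1 + y * v2) / r2) = 0 ->
  ((x - 1) * v2 - y * v1) * ((x + 1) * v1 + y * v2)
  + ((x + 1) * v2 - y * v1) * ((x - 1) * v1 + y * v2) = 0.
Proof.
  intros heps h1 h2 hv e1 e2 hne ht.
  (* [b1], [b2] are the scalar products of the focal vectors with [v], and [a1], [a2] the cross
     products. *)
  set (a1 := (x - 1) * v2 - y * v1). set (a2 := (x + 1) * v2 - y * v1).
  set (b1 := (x - 1) * v1 + y * v2) in *. set (b2 := (x + 1) * v1 + y * v2) in *.
  set (n := v1 ^ 2 + v2 ^ 2) in *.
  assert (hb : b1 * r2 = - eps * (b2 * r1)).
  { apply Rminus_diag_uniq.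
    transitivity ((b1 / r1 + eps * (b2 / r2)) * (r1 * r2)); [field; lra|].
    rewrite ht. ring. }
  assert (n1 : a1 ^ 2 + b1 ^ 2 = r1 ^ 2 * n) by (rewrite e1; unfold a1, b1, n; ring).
  assert (n2 : a2 ^ 2 + b2 ^ 2 = r2 ^ 2 * n) by (rewrite e2; unfold a2, b2, n; ring).
  assert (hd : a1 * a2 + b1 * b2 = ((r1 ^ 2 + r2 ^ 2) / 2 - 2) * n)
    by (rewrite e1, e2; unfold a1, a2, b1, b2, n; field).
  (* Tangency makes [b1 / r1] and [b2 / r2] equal up to sign; by [n1] and [n2] so are [a1 / r1] and
     [a2 / r2]. The two signs are the two cases below. *)
  assert (ha : (a1 * r2 - eps * (a2 * r1)) * (a1 * r2 + eps * (a2 * r1)) = 0).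
  { transitivity (r2 ^ 2 * (a1 ^ 2 + b1 ^ 2) - (b1 * r2) ^ 2 - eps ^ 2 * (a2 * r1) ^ 2);
    [ring|].
    rewrite n1, hb.
    transitivity (r1 ^ 2 * (r2 ^ 2 * n) - eps ^ 2 * (r1 ^ 2 * (a2 ^ 2 + b2 ^ 2)));
    [ring|]. rewrite n2, heps. ring. }
  destruct (Rmult_integral _ _ ha) as [ha' | ha'].
  - apply (Rmult_eq_reg_r (r1 * r2)); [| nra].
    transitivity ((a1 * r2) * (b2 * r1) + (a2 * r1) * (b1 * r2)); [ring|].
    rewrite hb. replace (a1 * r2) with (eps * (a2 * r1)) by lra. ring.
  (* Here the focal vectors are parallel, and the law of cosines [hd], with focal distance 2, forces
     the degenerate conic. *)
  - exfalso. apply hne.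
    assert (hd' : (a1 * a2 + b1 * b2) * (r1 * r2) = - eps * (r1 * r2) ^ 2 * n).
    { transitivity ((a1 * r2) * (a2 * r1) + (b1 * r2) * (b2 * r1)); [ring|].
      replace (a1 * r2) with (- eps * (a2 * r1)) by lra. rewrite hb.
      transitivity (- eps * r1 ^ 2 * (a2 ^ 2 + b2 ^ 2)); [ring|]. rewrite n2. ring. }
    rewrite hd in hd'.
    assert (hz : ((r1 ^ 2 + r2 ^ 2) / 2 - 2) + eps * (r1 * r2) = 0).
    { apply (Rmult_eq_reg_r (n * (r1 * r2)));
        [| apply Rgt_not_eq; repeat apply Rmult_lt_0_compat; assumption].
      lra. }
    transitivity (r1 ^ 2 + eps ^ 2 * r2 ^ 2 + 2 * (eps * (r1 * r2))); [ring|].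
    rewrite heps. lra.
Qed.

(** Differentiating the defining equation of the conic along a curve in [G] gives the tangency
    condition of the algebraic lemma; the bounds on [a] exclude the degenerate conics. *)
Lemma focal_lines_reflected_confocal (G : C -> Prop) (q v : C) :
  confocal_ellipse G \/ confocal_hyperbola G ->
  G q -> off_centers q -> v <> RtoC 0 -> tangent_to G q v ->
  ((Re q - 1) * Im v - Im q * Re v) * ((Re q + 1) * Re v + Im q * Im v)
  + ((Re q + 1) * Im v - Im q * Re v) * ((Re q - 1) * Re v + Im q * Im v) = 0.
Proof.
  intros hG hq hoff hv (g & hg0 & hg & hd1 & hd2).
  rewrite off_centers_iff in hoff.
  pose proof (hoff true) as h1. pose proof (hoff false) as h2.
  pose proof (Cmod_sub_real_sqr q 1) as e1.
  pose proof (Cmod_sub_real_sqr q (-1)) as e2.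
  unfold center in h1, h2.
  assert (hv2 : 0 < Re v ^ 2 + Im v ^ 2).
  { rewrite <- (Rminus_0_r (Re v)), <- Cmod_sub_real_sqr.
    apply pow_lt, Cmod_gt_0. intros h0. apply hv.
    replace v with ((v - RtoC 0) + RtoC 0)%C by ring. rewrite h0. ring. }
  rewrite <- hg0 in h1, h2.
  pose proof (is_derive_Cmod_sub_real g 1 0 _ _ hd1 hd2 h1) as d1.
  pose proof (is_derive_Cmod_sub_real g (-1) 0 _ _ hd1 hd2 h2) as d2.
  rewrite hg0 in *.
  assert (hfoci : Cmod (RtoC (-1) - RtoC 1) = 2).
  { rewrite Cmod_sub_real. cbn. replace (_ + _) with (2 * 2) by ring.
    apply sqrt_square. lra. }
  replace (Re q - -1) with (Re q + 1) in * by ring.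
  set (f := fun eps s => Cmod (g s - RtoC 1) + eps * Cmod (g s - RtoC (-1))).
  assert (hf : forall eps, is_derive (f eps) 0
    (((Re q - 1) * Re v + Im q * Im v) / Cmod (q - RtoC 1)
     + eps * (((Re q + 1) * Re v + Im q * Im v) / Cmod (q - RtoC (-1))))).
  { intros eps. exact (is_derive_plus _ _ _ _ _ d1 (is_derive_scal _ _ eps _ d2)). }
  destruct hG as [(a & ha & hG) | (a & ha & hG)]; rewrite hfoci in ha;
    apply hG in hq.
  - apply (focal_lines_reflected _ _ _ _ _ _ 1 ltac:(ring) h1 h2 hv2 e1 e2).
    { intros h4. rewrite Rmult_1_l, Rplus_comm, hq in h4.
      assert (0 < (a - 1) * (a - 1)) by (apply Rmult_lt_0_compat; lra). lra. }
    rewrite <- (is_derive_unique _ _ _ (hf 1)). apply is_derive_unique.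
    apply (is_derive_ext_loc (fun _ => 2 * a)); [| apply @is_derive_const].
    revert hg. apply filter_imp. intros s hs. apply hG in hs. unfold f. lra.
  (* The absolute value leaves the sign of [r1 - r2] open, so its square, constant near the
     parameter [0], is differentiated. This gives [c * l = 0], and [a > 0] keeps [c] nonzero. *)
  - assert (hsqr : forall r, Rabs r = 2 * a -> r ^ 2 = (2 * a) ^ 2).
    { intros r <-. symmetry. apply pow2_abs. }
    apply hsqr in hq.
    apply (focal_lines_reflected _ _ _ _ _ _ (-1) ltac:(ring) h1 h2 hv2 e1 e2).
    { intros h4. assert (0 < a * (1 - a)) by (apply Rmult_lt_0_compat; lra). lra. }
    generalize (hf (-1)).
    match goal with |- _ -> ?l = 0 => generalize l end. intros l hl.
    pose proof (is_derive_mult _ _ _ _ _ hl hl Rmult_comm) as hl2.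
    apply is_derive_unique in hl2.
    rewrite (is_derive_unique _ 0 0) in hl2.
    + unfold f in hl2. rewrite hg0 in hl2. cbn in hl2.
      set (c := Cmod (q - RtoC 1) + -1 * Cmod (q - RtoC (-1))) in hl2.
      assert (hc : c <> 0).
      { intros hc. assert (0 < a * a) by (apply Rmult_lt_0_compat; lra).
        replace (Cmod (q - RtoC (-1)) - Cmod (q - RtoC 1)) with (- c) in hq
          by (unfold c; ring).
        rewrite hc in hq. lra. }
      destruct (Rmult_integral c l); [lra | contradiction | assumption].
    + apply (is_derive_ext_loc (fun _ => (2 * a) ^ 2)); [| apply @is_derive_const].
      revert hg. apply filter_imp. intros s hs. apply hG, hsqr in hs.
      rewrite <- hs. unfold f. cbn. ring.
Qed.

Lemma erikson_hill_reflection (m1 m2 : R) (G : C -> Prop) (q p p' : C) :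
  confocal_ellipse G \/ confocal_hyperbola G ->
  G q -> off_centers q -> elastic_reflection G q p p' ->
  eval (erikson_hill m1 m2) (q, p') = eval (erikson_hill m1 m2) (q, p).
Proof.
  intros hG hq hoff (v & hv & htan & ht & hn).
  pose proof (focal_lines_reflected_confocal G q v hG hq hoff hv htan) as hopt.
  destruct q as [x y], p as [u1 u2], p' as [w1 w2], v as [v1 v2].
  cbn in *. unfold dot in *. cbn in *.
  (* The remaining terms depend on the position only, which leaves the product of the angular
     momenta. *)
  f_equal.
  assert (hv2 : v1 ^ 2 + v2 ^ 2 <> 0).
  { intros h0. apply hv. assert (v1 = 0) by nra. assert (v2 = 0) by nra.
    subst. reflexivity. }
  set (n := v1 ^ 2 + v2 ^ 2) in *.
  (* Up to the factor [n], [al] and [be] are the components of the momentum along [v] and [Ci * v];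
     reflection sends [be] to [- be]. *)
  set (al := u1 * v1 + u2 * v2) in *.
  set (be := u2 * v1 - u1 * v2) in *.
  assert (eu1 : u1 = (al * v1 - be * v2) / n)
    by (unfold al, be, n in *; field; exact hv2).
  assert (eu2 : u2 = (al * v2 + be * v1) / n)
    by (unfold al, be, n in *; field; exact hv2).
  assert (hbe : w2 * v1 - w1 * v2 = - be) by (unfold be; lra).
  assert (ew1 : w1 = (al * v1 + be * v2) / n).
  { replace be with (- (w2 * v1 - w1 * v2)) by lra. rewrite <- ht.
    unfold n in *. field. exact hv2. }
  assert (ew2 : w2 = (al * v2 - be * v1) / n).
  { replace be with (- (w2 * v1 - w1 * v2)) by lra. rewrite <- ht.
    unfold n in *. field. exact hv2. }
  clearbody n al be. subst u1 u2 w1 w2.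
  apply Rminus_diag_uniq.
  (* Only the mixed term in [al * be] changes; its coefficient is the expression in [hopt] divided
     by [n ^ 2]. *)
  match type of hopt with ?e = 0 => transitivity (- 4 * al * be / n ^ 2 * e / 2) end.
  - field. exact hv2.
  - rewrite hopt. field. exact hv2.
Qed.

(** * Independence on a dense subset of the energy hypersurface *)

(** The momentum components of the differentials of the two functions are
    linearly dependent exactly when this expression vanishes. *)
Definition momentum_jacobian (z : phase) : R :=
  let x := coord Cq1 z in let y := coord Cq2 z in
  let u := coord Cp1 z in let v := coord Cp2 z in
  x * y * (u ^ 2 - v ^ 2) + (y ^ 2 - x ^ 2 + 1) * (u * v).

(** Eliminating [a] from the two momentum equations leaves [2 * b] times the jacobian. Then [a]
    kills the momentum, which is nonzero since the jacobian vanishes at zero momentum. *)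
Lemma independent_of_momentum_jacobian (m1 m2 : R) (z : phase) :
  off_centers (fst z) -> momentum_jacobian z <> 0 ->
  independent_at (two_center_H m1 m2) (eval (erikson_hill m1 m2)) z.
Proof.
  intros hz hj a b hab.
  pose proof (hab Cp1) as h1. pose proof (hab Cp2) as h2.
  rewrite partial_two_center_H, partial_eval_self in h1, h2 by exact hz.
  destruct z as [[x y] [u v]]. unfold momentum_jacobian in hj. cbn in *.
  revert h1 h2. generalize (/ Cmod ((x, y) - RtoC 1)) as i1.
  generalize (/ Cmod ((x, y) - RtoC (-1))) as i2. intros i2 i1 h1 h2.
  assert (hb : b = 0).
  { match type of hj with ?j <> 0 =>
      match type of h1 with ?e1 = 0 => match type of h2 with ?e2 = 0 =>
        assert (h : 2 * b * j = e1 * v - e2 * u) by field end end end.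
    rewrite h1, h2, Rmult_0_l, Rmult_0_l, Rminus_0_r in h.
    destruct (Rmult_integral _ _ h); [lra | contradiction]. }
  split; [| exact hb]. subst b.
  destruct (Req_dec a 0) as [| ha]; [assumption | exfalso].
  assert (hu : a * u = 0) by lra. assert (hv : a * v = 0) by lra.
  destruct (Rmult_integral _ _ hu), (Rmult_integral _ _ hv); try contradiction.
  subst u v. apply hj. ring.
Qed.

(** The jacobian is a trace-free quadratic form in the momentum, so a rotation by [al] acts on it
    through the angle [2 * al]. From the value 0 it moves to [sin al * cos al * j], and both factors
    in front of [j] are positive. *)
Lemma momentum_jacobian_rotation (x y u v al : R) :
  off_centers (x, y) -> (u, v) <> RtoC 0 -> momentum_jacobian ((x, y), (u, v)) = 0 ->
  0 < al < PI / 2 ->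
  momentum_jacobian
    ((x, y), (u * cos al - v * sin al, u * sin al + v * cos al)) <> 0.
Proof.
  intros hq hp hj hal h.
  set (A := x * y). set (B := y ^ 2 - x ^ 2 + 1).
  unfold momentum_jacobian in h, hj. cbn [coord fst snd Re Im] in h, hj.
  fold A B in h, hj.
  set (j := B * (u ^ 2 - v ^ 2) - 4 * A * (u * v)).
  assert (hs : 0 < sin al) by (apply sin_gt_0; lra).
  assert (hc : 0 < cos al) by (apply cos_gt_0; lra).
  assert (hj0 : j = 0).
  { apply (Rmult_eq_reg_l (sin al * cos al)).
    2:{ apply Rgt_not_eq, Rmult_lt_0_compat; assumption. }
    rewrite Rmult_0_r, <- h.
    transitivity ((A * (u ^ 2 - v ^ 2) + B * (u * v)) * (cos al ^ 2 - sin al ^ 2)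
                  + sin al * cos al * j); [rewrite hj; ring | unfold j; ring]. }
  (* The factor [4 * A ^ 2 + B ^ 2] is the squared modulus of [q ^ 2 - 1], which vanishes only at
     the centers. *)
  assert (hAB : (4 * A ^ 2 + B ^ 2) * (u ^ 2 + v ^ 2) ^ 2 = 0).
  { transitivity (4 * (A * (u ^ 2 - v ^ 2) + B * (u * v)) ^ 2 + j ^ 2);
    [unfold j; ring | rewrite hj, hj0; ring]. }
  destruct (Rmult_integral _ _ hAB) as [h0 | h0].
  - destruct (Rplus_sqr_eq_0 (2 * A) B) as [hA hB]; [unfold Rsqr; lra|].
    assert (hA' : x * y = 0) by (unfold A in hA; lra). clear hA.
    unfold B in hB. destruct hq as [hq1 hq2].
    assert (hy : y = 0)
      by (destruct (Rmult_integral _ _ hA') as [-> |]; [nra | assumption]).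
    subst y.
    assert (hx : (x - 1) * (x + 1) = 0) by lra.
    destruct (Rmult_integral _ _ hx); [apply hq2 | apply hq1];
      apply injective_projections; cbn; lra.
  - apply hp. destruct (Rplus_sqr_eq_0 u v) as [-> ->]; [| reflexivity].
    apply Rsqr_0_uniq. unfold Rsqr. lra.
Qed.

Lemma continuous_pair {T U V : UniformSpace} (f : T -> U) (g : T -> V) (x : T) :
  continuous f x -> continuous g x -> continuous (fun t => (f t, g t)) x.
Proof.
  intros hf hg. apply (continuous_comp_2 f g pair x hf hg).
  intros P [eps hP]. exists eps. intros [u v] huv. apply hP, huv.
Qed.

Lemma partial_momentum_two_center_H (m1 m2 : R) (z : phase) :
  off_centers (fst z) -> snd z <> RtoC 0 ->
  exists k, partial k (two_center_H m1 m2) z <> 0.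
Proof.
  intros hq hp. destruct (Req_dec (coord Cp1 z) 0) as [h1 | h1].
  - exists Cp2. rewrite partial_two_center_H by exact hq. cbn. intros h2. apply hp.
    apply injective_projections; cbn in *; unfold Re, Im in *; lra.
  - exists Cp1. rewrite partial_two_center_H by exact hq. cbn in *. intros h2. lra.
Qed.

Lemma independent_near_moving (m1 m2 e : R) (z : phase) (N : phase -> Prop) :
  on_energy_level off_centers (two_center_H m1 m2) e z -> snd z <> RtoC 0 ->
  locally z N ->
  exists z', N z' /\
    on_energy_hypersurface off_centers (two_center_H m1 m2) e z' /\
    independent_at (two_center_H m1 m2) (eval (erikson_hill m1 m2)) z'.
Proof.
  intros [hq he] hp hN.
  destruct (Req_dec (momentum_jacobian z) 0) as [hj | hj].
  2:{ exists z. split; [exact (locally_singleton _ _ hN)|].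
      split; [split; [split; assumption |] |].
      - apply partial_momentum_two_center_H; assumption.
      - apply independent_of_momentum_jacobian; assumption. }
  destruct z as [[x y] [u v]].
  set (w := fun al : R => ((x, y), (u * cos al - v * sin al, u * sin al + v * cos al))
                          : phase).
  assert (hw0 : w 0 = ((x, y), (u, v))).
  { unfold w. rewrite cos_0, sin_0. do 2 f_equal; ring. }
  assert (hcont : continuous w 0).
  { apply continuous_pair; [apply continuous_const|].
    apply continuous_pair;
      apply (@ex_derive_continuous R_AbsRing R_NormedModule); auto_derive; trivial. }
  assert (hNw : locally (w 0) N) by (rewrite hw0; exact hN).
  apply hcont in hNw. destruct hNw as [eps heps].
  (* Half of [eps] keeps the rotated point in [N]; the bound 1 keeps the angle below [PI / 2]. *)
  set (al := Rmin (eps / 2) 1).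
  assert (hal : 0 < al < PI / 2 /\ al < eps).
  { pose proof (cond_pos eps). pose proof PI2_1.
    unfold al, Rmin. destruct (Rle_dec (eps / 2) 1); lra. }
  destruct hal as [hal haleps].
  pose proof (momentum_jacobian_rotation x y u v al hq hp hj hal) as hj'.
  assert (hp' : snd (w al) <> RtoC 0).
  { intros h0. apply hj'. unfold w in h0. cbn in h0. injection h0 as h1 h2.
    unfold momentum_jacobian. cbn. rewrite h1, h2. ring. }
  exists (w al). split; [| split; [split; [split|] |]].
  - apply heps. change (Rabs (al - 0) < eps). rewrite Rminus_0_r, Rabs_pos_eq; lra.
  - exact hq.
  - rewrite <- he, !two_center_H_eval. cbn.
    pose proof (sin2_cos2 al) as hsc. unfold Rsqr in hsc.
    f_equal. transitivity
      (/ 2 * ((u * u + v * v) * (sin al * sin al + cos al * cos al))); [ring|].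
    rewrite hsc. ring.
  - apply partial_momentum_two_center_H; assumption.
  - apply independent_of_momentum_jacobian; assumption.
Qed.

(** Otherwise [x] would be a local minimum, and the derivative there would vanish. *)
Lemma decreasing_near (f : R -> R) (x l : R) (P : R -> Prop) :
  is_derive f x l -> l <> 0 -> locally x P -> exists t, P t /\ f t < f x.
Proof.
  intros hf hl [eps hP]. apply NNPP. intros hno. apply hl.
  pose proof (cond_pos eps) as heps.
  apply is_derive_Reals in hf.
  transitivity (derive_pt f x (exist _ l hf)); [reflexivity|].
  apply (deriv_minimum f (x - eps) (x + eps)); [lra | lra |].
  intros t ht1 ht2. apply Rnot_lt_le. intros hlt. apply hno. exists t.
  split; [| exact hlt]. apply hP. change (Rabs (t - x) < eps).
  apply Rabs_def1; lra.
Qed.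

(** At rest the energy is the potential alone; the deficit [e - h] is supplied as kinetic energy. *)
Lemma eval_energy_kick (m1 m2 e h : R) (q : C) :
  h = eval (energy m1 m2) (q, RtoC 0) -> h <= e ->
  eval (energy m1 m2) (q, (sqrt (2 * (e - h)), 0)) = e.
Proof.
  intros hh hle. pose proof (sqrt_def (2 * (e - h)) ltac:(lra)) as hsq.
  cbn in *. lra.
Qed.

Lemma independent_near (m1 m2 e : R) (z : phase) (N : phase -> Prop) :
  on_energy_hypersurface off_centers (two_center_H m1 m2) e z ->
  locally z N ->
  exists z', N z' /\
    on_energy_hypersurface off_centers (two_center_H m1 m2) e z' /\
    independent_at (two_center_H m1 m2) (eval (erikson_hill m1 m2)) z'.
Proof.
  intros [[hq he] [k hk]] hN.
  destruct (Ceq_dec (snd z) (RtoC 0)) as [hp | hp].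
  2:{ apply (independent_near_moving m1 m2 e z N); trivial. split; assumption. }
  rewrite partial_two_center_H in hk by exact hq.
  pose proof (is_derive_eval_set_coord (energy m1 m2) k z hq) as hd.
  set (f := fun s => eval (energy m1 m2) (set_coord k z s)) in hd.
  assert (hf0 : f (coord k z) = e).
  { unfold f. rewrite set_coord_id, <- two_center_H_eval. exact he. }
  (* The curve moves one coordinate and corrects the energy by a momentum; this momentum is zero at
     the start, so the curve passes through [z]. *)
  set (w := fun s => (fst (set_coord k z s), (sqrt (2 * (e - f s)), 0)) : phase).
  assert (hw0 : w (coord k z) = z).
  { unfold w. rewrite hf0, set_coord_id, Rminus_diag, Rmult_0_r, sqrt_0.
    destruct z as [q p]. cbn in *. rewrite hp. reflexivity. }
  assert (hcont : continuous w (coord k z)).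
  { apply continuous_pair.
    - apply (continuous_comp (set_coord k z) fst);
        [apply continuous_set_coord|].
      rewrite set_coord_id. destruct z. apply continuous_fst.
    - apply continuous_pair; [| apply continuous_const].
      apply (continuous_comp (fun s => 2 * (e - f s)) sqrt); [| apply continuous_sqrt].
      apply (@ex_derive_continuous R_AbsRing R_NormedModule). auto_derive.
      repeat split. eexists. exact hd. }
  (* [N] must still be a neighborhood of the displaced point [w s]. *)
  apply locally_locally in hN.
  pose proof (filter_and _ _ hN (locally_off_centers z hq)) as hN2.
  rewrite <- hw0 in hN2. apply hcont in hN2.
  destruct (decreasing_near f _ _ _ hd hk hN2) as (s & [hNs hqs] & hs).
  rewrite hf0 in hs.
  apply (independent_near_moving m1 m2 e (w s) N); [split; [exact hqs|] | | exact hNs].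
  - rewrite two_center_H_eval.
    apply eval_energy_kick; [| lra].
    (* At zero momentum the momentum partials of the energy vanish, so [hk] forces [k] to be a
       position coordinate and [f] measures the energy at rest. *)
    unfold f. destruct z as [[x y] p]. cbn [snd] in hp. subst p.
    destruct k; cbn in hk; [reflexivity | reflexivity | lra | lra].
  - intros h0. injection h0 as h0.
    pose proof (sqrt_lt_R0 (2 * (e - f s))). lra.
Qed.

Theorem theorem6 (m1 m2 : R) (W : (C -> Prop) -> Prop)
  (hW : forall G : C -> Prop, W G -> confocal_ellipse G \/ confocal_hyperbola G) :
  integrable_reflection_wall off_centers (two_center_H m1 m2) W.
Proof.
  intros e. exists (eval (erikson_hill m1 m2)). split; [| split; [| split]].
  - apply smooth_eval.
  - intros z hz N hN. apply (independent_near m1 m2 e z N hz hN).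
  - intros a b z hz _. exact (erikson_hill_motion m1 m2 a b z hz).
  - intros G hG q p p' hq [hoff _] hrefl.
    exact (erikson_hill_reflection m1 m2 G q p p' (hW G hG) hq hoff hrefl).
Qed.
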